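(* Let $\alpha>-1$, $\beta\in\mathbb{R}$, $k^2\in(0,1)$, and let $\beta_n$ be the recurrence coefficients of the monic polynomials orthogonal with respect to $w(x,k^2)=(1-x^2)^{\alpha}(1-k^2x^2)^{\beta}$ on $[-1,1]$. Then for every $n\ge1$, $\beta_n$ satisfies the third-order difference equation $$\begin{aligned} &(\beta_{n+1}-\beta_n)^2\Big\{4k^4\beta_n\Big[\big(\alpha+\beta+n+\tfrac32\big)\big(\alpha+\beta+n-\tfrac12\big)\beta_{n+1}+\big(\alpha+\beta+n+\tfrac12\big)\big(\alpha+\beta+n-\tfrac32\big)\beta_{n-1}\Big]\\ &\quad+4k^2\big(\alpha+\beta+n+\tfrac12\big)\big(\alpha+\beta+n-\tfrac12\big)\beta_n\big(2k^2\beta_n-k^2-1\big)+(\alpha k^2+\beta)^2+k^2n(n+2\alpha+2\beta)\Big\}\\ ={}&\Big\{\beta_{n+1}\Big[k^2\big(\alpha+\beta+n+\tfrac52\big)(\beta_{n+2}+\beta_{n+1})-(k^2+1)\big(\alpha+\beta+n+\tfrac32\big)\Big]\\ &\quad-\beta_n\Big[k^2\big(\alpha+\beta+n+\tfrac12\big)(\beta_n+\beta_{n-1})-(k^2+1)\big(\alpha+\beta+n-\tfrac12\big)\Big]\\ &\quad+\tfrac12+2k^2\beta_n\Big[\big(\alpha+\beta+n+\tfrac12\big)(\beta_{n+1}-\beta_n)+\beta_n+\beta_{n-1}\Big]\Big\}^2 . \end{aligned}$$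
   Context: For $\alpha>-1$, $\beta\in\mathbb{R}$, $k^2\in(0,1)$, the weight is $w(x,k^2)=(1-x^2)^{\alpha}(1-k^2x^2)^{\beta}$, $x\in[-1,1]$. For $n\ge0$, $P_n$ is the monic polynomial of degree $n$ with $\int_{-1}^1 P_i(x)P_j(x)w(x,k^2)\,dx=h_j\delta_{i,j}$. The recurrence coefficients $\beta_n$ (with an index; $\beta$ without index is the exponent) are defined by $xP_n(x)=P_{n+1}(x)+\beta_nP_{n-1}(x)$, with $P_{-1}:=0$, $\beta_0:=0$; thus $\beta_n=h_n/h_{n-1}$ for $n\ge1$. *)

(* Defs.v *)
From HB Require Import structures.
From mathcomp Require Import all_boot all_order all_algebra.
From mathcomp Require Import all_classical all_reals all_analysis.

Set Implicit Arguments.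
Unset Strict Implicit.
Unset Printing Implicit Defensive.

Import Order.TTheory GRing.Theory Num.Theory.
Import numFieldNormedType.Exports.

Local Open Scope classical_set_scope.
Local Open Scope ring_scope.

(* At x = -1 and x = 1, where the power is singular if alpha < 0, [powR] takes
   the value 0; this is a Lebesgue-null set. *)
Definition weight (R : realType) (alpha beta k2 x : R) : R :=
  (1 - x ^+ 2) `^ alpha * (1 - k2 * x ^+ 2) `^ beta.

(* The integral is the extended real one, so that the equation includes the
   finiteness of its value. *)
Definition monic_orthogonal (R : realType) (w : R -> R)
    (P : nat -> {poly R}) (h : nat -> R) : Prop :=
  [/\ forall n : nat, P n \is monic,
      forall n : nat, size (P n) = n.+1
    & forall i j : nat,
        (\int[@lebesgue_measure R]_(x in `[(-1)%R, 1%R])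
            ((P i).[x] * (P j).[x] * w x)%:E)%E
        = (if i == j then h j else 0)%:E].

(* P_{n-1}, with P_{-1} := 0. *)
Definition pred_poly (R : realType) (P : nat -> {poly R}) (n : nat) : {poly R} :=
  if n is m.+1 then P m else 0.

Definition recurrence_coeffs (R : realType) (P : nat -> {poly R})
    (b : nat -> R) : Prop :=
  b 0%N = 0 /\
  forall n : nat, 'X * P n = P n.+1 + b n *: pred_poly P n.

(* Main.v *)
Require Import Defs.
From HB Require Import structures.
From mathcomp Require Import all_boot all_order all_algebra.
From mathcomp Require Import all_classical all_reals all_analysis.
From mathcomp Require Import measurable_realfun ring lra.

(** Write [q = k^2], [W = (1 - x^2) (1 - q x^2)], [V = - W w' / w], which is
    the odd cubic polynomial [2 kappa x - 2 q tau x^3] with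
    [kappa = alpha + beta q] and [tau = alpha + beta], and let [L p] be the
    integral of [p w] over [[-1, 1]].

    The only analytic input is Pearson's equation [(W w)' = (W' - V) w],
    integrated against a polynomial: [L (W p' + (W' - V) p) = 0]
    ([pearson_integral]).  The boundary terms vanish because
    [W w = (1 - x^2)^(alpha + 1) (1 - q x^2)^(beta + 1)] does at the endpoints,
    [alpha + 1] being positive.  Convergence of the integrals comes from the
    orthogonality relations themselves: [L 1 = h_0] is finite.

    Semiclassical orthogonal polynomials have a lowering operator
    [W P_n' = - B_n P_n + b_n A_n P_{n-1}].  Here [A_n = a2_n x^2 + a0_n] and
    [B_n = c1_n x - q n x^3], where [a2_n] is explicit.  The coefficients [c1_n]
    and [a0_n] are defined directly from the [b_j], in the only way that is
    compatible with [x P_n = P_{n+1} + b_n P_{n-1}]; then the lowering relation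
    passes from [n] to [n + 1] by pure algebra, except for one scalar, which
    has to satisfy the string equation [b_{n+1} a0_{n+1} = 1 + b_n a0_{n-1}].
    Pearson's equation for [p = P_{n+1} P_n] provides exactly that
    ([string_of_lowering], [orthogonal_string]).

    The rest is about the sequence [b] alone.  Summing the string equation
    against the other two recurrences gives two first integrals
    ([ladder_sum_X4], [ladder_sum_X2]); these are the coefficients of [x^4] and
    [x^2] in the relation
    [B_n^2 + V B_n + W (A_0 + ... + A_{n-1}) = b_n A_n A_{n-1}].
    Eliminating the sum of the [a0_j] leaves one quadratic equation for [c1_n]
    with coefficients in [b_{n-1}], [b_n], [b_{n+1}]; completing the square, it
    says that the brace on the left of the difference equation is [z^2], where
    [z] is [c1_n] plus explicit terms.  On the other hand the string equation
    is linear in [c1_n], with leading coefficient proportional to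
    [b_{n+1} - b_n], and it says that the brace on the right is
    [(b_{n+1} - b_n) z].  Comparing the two eliminates [c1_n]
    ([third_order_of_string]). *)

Set Implicit Arguments.
Unset Strict Implicit.
Unset Printing Implicit Defensive.

Import Order.TTheory GRing.Theory Num.Theory.
Import numFieldNormedType.Exports.

Local Open Scope classical_set_scope.
Local Open Scope ring_scope.

(** * From the string equation to the third-order equation *)

(** Proves an equation as a consequence of another one: what remains is a ring
    identity between the two differences. *)
Lemma eq_of_subr_eq (V : zmodType) (x y u v : V) :
  x = y -> u - v = x - y -> u = v.
Proof. by move=> ->; rewrite subrr => /subr0_eq. Qed.

Section StringToThirdOrder.
Variables (R : realFieldType) (q kappa tau : R) (b : nat -> R).

(** The coefficients of the lowering operator are [ladderA2 n] and [ladderA0 n]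
    (of [x^2] and [1] in [A_n]) and [ladderB1 n] (of [x] in [B_n]).  The term
    [ladderA2 j + 2 * q] is [ladderA2] at [j - 1], written so that it makes
    sense at [j = 0]. *)
Definition ladderA2 (n : nat) : R := - q * (2 * n%:R + 1 + 2 * tau).

Definition ladderB1 (n : nat) : R :=
  \sum_(j < n) (1 + q + b j.+1 * ladderA2 j.+1 - b j * (ladderA2 j + 2 * q)).

Definition ladderA0 (n : nat) : R := ladderB1 n.+1 + ladderB1 n + 2 * kappa.

(** At [n = 0] the index [n.-1] stands for [-1]: with [b 0 = 0] the last term
    vanishes, in agreement with [P_{-1} = 0]. *)
Definition string_equation (n : nat) : Prop :=
  b n.+1 * ladderA0 n.+1 = 1 + b n * ladderA0 n.-1.

Lemma ladderA2S n : ladderA2 n.+1 = ladderA2 n - 2 * q.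
Proof. by rewrite /ladderA2 -natr1; ring. Qed.

Lemma ladderB1S n : ladderB1 n.+1 =
  ladderB1 n + (1 + q + b n.+1 * ladderA2 n.+1 - b n * (ladderA2 n + 2 * q)).
Proof. by rewrite /ladderB1 big_ord_recr. Qed.

Lemma ladderA0E n : ladderA0 n = 2 * ladderB1 n + 2 * kappa
  + (1 + q + b n.+1 * (ladderA2 n - 2 * q) - b n * (ladderA2 n + 2 * q)).
Proof. by rewrite /ladderA0 ladderB1S ladderA2S; ring. Qed.

Hypothesis b0 : b 0%N = 0.

(** The [x^4] coefficient of
    [B_n^2 + V B_n + W (A_0 + ... + A_{n-1}) = b_n A_n A_{n-1}]; the increment
    in [n] of the difference of the two sides is [ladderA2 n] times the
    recurrence [ladderB1S]. *)
Lemma ladder_sum_X4 n :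
  q * (\sum_(j < n) ladderA0 j) =
  2 * q * (n%:R + tau) * ladderB1 n + 2 * kappa * n%:R * q
  - (1 + q) * q * n%:R * (n%:R + 2 * tau)
  + b n * ladderA2 n * (ladderA2 n + 2 * q).
Proof.
elim: n => [|n IHn]; first by rewrite /ladderB1 !big_ord0 b0; ring.
rewrite big_ord_recr/= mulrDr IHn ladderA0E ladderB1S ladderA2S /ladderA2.
by rewrite -natr1; ring.
Qed.

(** The [x^2] coefficient of the same relation.  The quadratic terms have
    increment [(ladderB1 n.+1 - ladderB1 n) * ladderA0 n], and the induction
    step then amounts to [ladderA2 n] times the string equation. *)
Lemma ladder_sum_X2 (string : forall n, string_equation n) n :
  ladderB1 n ^+ 2 + 2 * kappa * ladderB1 n - q * n%:R * (n%:R + 2 * tau)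
  - (1 + q) * (\sum_(j < n) ladderA0 j) =
  b n * (ladderA2 n * ladderA0 n.-1 + ladderA0 n * (ladderA2 n + 2 * q)).
Proof.
elim: n => [|n IHn]; first by rewrite /ladderB1 !big_ord0 b0; ring.
have := string n; rewrite /string_equation big_ord_recr/= ladderA2S -natr1.
have aE : ladderA2 n = - q * (2 * n%:R + 1 + 2 * tau) by [].
rewrite ladderB1S ladderA2S; move: IHn (ladderA0E n) aE.
move: (\sum_(i < n) ladderA0 i) (ladderB1 n) => S B.
move: (ladderA0 n.+1) (ladderA0 n.-1) (ladderA0 n) (ladderA2 n) => r' rm r a.
move=> IHn rE aE stringn; apply: (eq_of_subr_eq IHn).
by ring: stringn rE aE.
Qed.

(** With [kappa = alpha + beta * q] and [tau = alpha + beta], the combination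
    [(1 + q) * tau - kappa] is [alpha * q + beta]. *)
Lemma third_order_of_string (q0 : q != 0)
    (string : forall n, string_equation n) n :
  (b n.+2 - b n.+1) ^+ 2 *
    (4 * q ^+ 2 * b n.+1 *
       ((tau + n.+1%:R + 3 / 2) * (tau + n.+1%:R - 1 / 2) * b n.+2
        + (tau + n.+1%:R + 1 / 2) * (tau + n.+1%:R - 3 / 2) * b n)
     + 4 * q * (tau + n.+1%:R + 1 / 2) * (tau + n.+1%:R - 1 / 2) * b n.+1
       * (2 * q * b n.+1 - q - 1)
     + ((1 + q) * tau - kappa) ^+ 2
     + q * n.+1%:R * (n.+1%:R + 2 * tau))
  =
  (b n.+2 *
     (q * (tau + n.+1%:R + 5 / 2) * (b n.+3 + b n.+2)
      - (q + 1) * (tau + n.+1%:R + 3 / 2))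
   - b n.+1 *
     (q * (tau + n.+1%:R + 1 / 2) * (b n.+1 + b n)
      - (q + 1) * (tau + n.+1%:R - 1 / 2))
   + 1 / 2
   + 2 * q * b n.+1 *
     ((tau + n.+1%:R + 1 / 2) * (b n.+2 - b n.+1) + b n.+1 + b n)) ^+ 2.
Proof.
pose N : R := n.+1%:R.
rewrite -/N; set X := (X in _ * X = _); set Y := RHS.
(* The quantity whose square appears when the quadratic equation for
   [ladderB1 n.+1] is completed. *)
pose z := ladderB1 n.+1 + kappa - (1 + q) * (tau + N)
  + 4 * q * (tau + N) * b n.+1.
have aE : ladderA2 n.+1 = - q * (2 * N + 1 + 2 * tau) by [].
(* Both recurrences for [ladderB1] at [n.+1] give [ladderA0 n] in terms of
   [ladderA0 n.+1]. *)
have rE : ladderA0 n = ladderA0 n.+1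
    - (2 * (1 + q) + b n.+2 * (ladderA2 n.+1 - 2 * q)
       - b n.+1 * (ladderA2 n.+1 + 2 * q) + b n.+1 * ladderA2 n.+1
       - b n * (ladderA2 n.+1 + 4 * q)).
  by rewrite /ladderA0 !ladderB1S !ladderA2S; ring.
have XE : X = z ^+ 2.
  have X2 := ladder_sum_X2 string n.+1.
  have X4 := ladder_sum_X4 n.+1.
  rewrite -[n.+1.-1]/n rE (ladderA0E n.+1) -/N in X2.
  rewrite -/N in X4; rewrite /z /X.
  move: (\sum_(i < n.+1) ladderA0 i) X2 X4 => S X2 X4.
  move: (ladderB1 n.+1) X2 X4 => B X2 X4.
  apply: (mulfI q0).
  move/(congr1 ( *%R q)) : X2; rewrite mulrBr (mulrCA q (1 + q)) X4 aE => X2.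
  by apply: (eq_of_subr_eq (esym X2)); field.
have YE : Y = ((b n.+2 - b n.+1) * z) ^+ 2.
  congr (_ ^+ 2); have := string n.+1.
  rewrite /string_equation -[n.+1.-1]/n rE /ladderA0 (ladderB1S n.+2).
  rewrite !(ladderB1S n.+1) !(ladderA2S n.+2) !(ladderA2S n.+1) aE /z.
  move: (ladderB1 n.+1) => B stringn.
  by apply: (eq_of_subr_eq (congr1 ( *%R (1 / 2)) (esym stringn))); field.
by rewrite XE YE exprMn.
Qed.

End StringToThirdOrder.

(** * The lowering operator and the string equation *)

Section StringEquation.
Variables (R : realType) (q kappa tau : R) (b h : nat -> R).
Variables (P : nat -> {poly R}) (L : {scalar {poly R}}).

Notation a2 := (ladderA2 q tau).
Notation c1 := (ladderB1 q tau b).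
Notation a0 := (ladderA0 q kappa tau b).

Definition pearsonW : {poly R} := (1 - 'X ^+ 2) * (1 - q%:P * 'X ^+ 2).

(** With [kappa = alpha + beta * q] and [tau = alpha + beta], this is
    [- W w' / w]. *)
Definition pearsonV : {poly R} :=
  (2 * kappa)%:P * 'X - (2 * q * tau)%:P * 'X ^+ 3.

Definition ladderA n : {poly R} :=
  (a2 n)%:P * 'X ^+ 2 + (a0 n)%:P.

Definition ladderB n : {poly R} :=
  (c1 n)%:P * 'X - (q * n%:R)%:P * 'X ^+ 3.

Lemma ladder_compat1 n : ladderB n.+1 + ladderB n = 'X * ladderA n - pearsonV.
Proof.
rewrite /ladderB /ladderA /pearsonV /ladderA0 /ladderA2.
by rewrite -natr1; ring.
Qed.

Lemma ladder_compat2 n :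
  pearsonW + 'X * (ladderB n.+1 - ladderB n) =
  (b n.+1 * a2 n.+1 - b n * (a2 n + 2 * q))%:P * 'X ^+ 2 + 1.
Proof. by rewrite /ladderB /pearsonW ladderB1S -natr1; ring. Qed.

Definition lowering n : Prop :=
  pearsonW * (P n)^`() + ladderB n * P n =
  (b n)%:P * ladderA n * pred_poly P n.

(** The relation [lowering n.+1] before the string equation is known: the
    constant term of the last factor is what the three-term recurrence
    produces, in place of [b n.+1 * a0 n.+1]. *)
Definition prelowering n : Prop :=
  pearsonW * (P n.+1)^`() + ladderB n.+1 * P n.+1 =
  P n * ((b n.+1 * a2 n.+1)%:P * 'X ^+ 2
         + (1 + b n * a0 n.-1)%:P).

Hypotheses (P0 : P 0%N = 1) (b0 : b 0%N = 0)
  (recP : forall n, 'X * P n = P n.+1 + b n *: pred_poly P n)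
  (orthP : forall i j, L (P i * P j) = if i == j then h j else 0)
  (h_neq0 : forall n, h n != 0)
  (pearsonL :
     forall p, L (pearsonW * p^`() + (pearsonW^`() - pearsonV) * p) = 0).

Let LZ c p : L (c%:P * p) = c * L p.
Proof. by rewrite mul_polyC linearZ. Qed.

Let rec0 : 'X * P 0 = P 1.
Proof. by rewrite recP b0 scale0r addr0. Qed.

Let recS n : 'X * P n.+1 = P n.+2 + (b n.+1)%:P * P n.
Proof. by rewrite recP mul_polyC. Qed.

Let rec_pred n : (b n)%:P * pred_poly P n = 'X * P n - P n.+1.
Proof. by rewrite recP -mul_polyC; ring. Qed.

(** With the norms, the moments [moment1], [moment2] and [moment3] are all that
    Pearson's equation for [P n.+1 * P n] involves. *)
Lemma moment1 n : L ('X * P n.+1 * P n) = h n.+1.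
Proof.
case: n => [|n]; first by rewrite mulrAC rec0 orthP.
rewrite mulrAC recS mulrDl linearD/= -mulrA LZ !orthP eqxx.
by rewrite ltn_eqF// mulr0 addr0.
Qed.

Lemma norm_rec n : h n.+1 = b n.+1 * h n.
Proof.
rewrite -moment1 recS mulrDl linearD/= -mulrA LZ !orthP eqxx.
by rewrite gtn_eqF ?add0r.
Qed.

Lemma moment2 n : L ('X ^+ 2 * (P n * P n)) = h n * (b n.+1 + b n).
Proof.
have -> : 'X ^+ 2 * (P n * P n) = ('X * P n) * ('X * P n) by ring.
case: n => [|n]; first by rewrite rec0 orthP eqxx norm_rec b0; ring.
rewrite recS (_ : _ * _ = P n.+2 * P n.+2 + (2 * b n.+1)%:P * (P n.+2 * P n)
  + (b n.+1 ^+ 2)%:P * (P n * P n)); last by ring.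
by rewrite !linearD/= !LZ !orthP !eqxx gtn_eqF// !norm_rec; ring.
Qed.

Lemma moment3 n :
  L ('X ^+ 3 * (P n.+1 * P n)) = h n.+1 * (b n.+2 + b n.+1 + b n).
Proof.
case: n => [|n].
  have -> : 'X ^+ 3 * (P 1 * P 0) = 'X ^+ 2 * (P 1 * P 1).
    by rewrite -rec0; ring.
  by rewrite moment2 b0 addr0.
have -> : 'X ^+ 3 * (P n.+2 * P n.+1) = 'X ^+ 2 * (P n.+2 * P n.+2)
    + (b n.+1)%:P * ('X * (P n.+2 * ('X * P n))).
  transitivity ('X ^+ 2 * P n.+2 * ('X * P n.+1)); first by ring.
  by rewrite recS; ring.
rewrite linearD/= LZ moment2 recP.
have -> : 'X * (P n.+2 * (P n.+1 + b n *: pred_poly P n)) =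
    'X * P n.+2 * P n.+1 + (b n)%:P * (('X * P n.+2) * pred_poly P n).
  by rewrite -mul_polyC; ring.
rewrite linearD/= LZ moment1 recS.
have -> : b n * L ((P n.+3 + (b n.+2)%:P * P n.+1) * pred_poly P n) = 0.
  case: n => [|n]; first by rewrite b0 mul0r.
  rewrite mulrDl -mulrA linearD/= LZ !orthP !gtn_eqF ?mulr0 ?addr0 ?mulr0//.
  exact: (leq_addl 3 n.+1).
by rewrite !norm_rec; ring.
Qed.

(** In Pearson's equation for [P n.+1 * P n], the lowering relations replace
    both derivatives; the terms with [ladderB] cancel against [pearsonV] by
    [ladder_compat1], and only the moments above remain. *)
Lemma string_of_lowering n :
  lowering n -> prelowering n -> string_equation q kappa tau b n.
Proof.
rewrite /lowering /prelowering => low0 low1.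
have := pearsonL (P n.+1 * P n).
have -> : pearsonW * (P n.+1 * P n)^`()
    + (pearsonW^`() - pearsonV) * (P n.+1 * P n) =
  P n * (P n * ((b n.+1 * a2 n.+1)%:P * 'X ^+ 2
                + (1 + b n * a0 n.-1)%:P))
  - ladderA n * (P n.+1 * P n.+1) + pearsonW^`() * (P n.+1 * P n).
  rewrite -low1 derivM.
  have low : pearsonW * (P n)^`() =
      ladderA n * ('X * P n - P n.+1) - ladderB n * P n.
    by rewrite -rec_pred; apply: (eq_of_subr_eq low0); ring.
  have -> : pearsonV = 'X * ladderA n - ladderB n.+1 - ladderB n.
    by apply: (eq_of_subr_eq (ladder_compat1 n)); ring.
  by apply: (eq_of_subr_eq (congr1 ( *%R (P n.+1)) low)); ring.
have -> : pearsonW^`() = (4 * q)%:P * 'X ^+ 3 - (2 * (1 + q))%:P * 'X.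
  by rewrite /pearsonW !poly.derivE; ring.
rewrite /ladderA; set E := (X in L X = 0 -> _).
have -> : E = (b n.+1 * a2 n.+1)%:P * ('X ^+ 2 * (P n * P n))
    + (1 + b n * a0 n.-1)%:P * (P n * P n)
    + (- a2 n)%:P * ('X ^+ 2 * (P n.+1 * P n.+1))
    + (- a0 n)%:P * (P n.+1 * P n.+1)
    + (4 * q)%:P * ('X ^+ 3 * (P n.+1 * P n))
    + (- (2 * (1 + q)))%:P * ('X * P n.+1 * P n).
  by rewrite /E; ring.
rewrite !linearD/= !LZ !moment2 moment3 moment1 !orthP !eqxx norm_rec => eq0.
apply: (mulfI (h_neq0 n)); apply: (eq_of_subr_eq (esym eq0)).
move: (a0 n.-1) => rm.
rewrite /ladderA0 !ladderB1S !ladderA2S /ladderA2.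
by ring.
Qed.

Lemma lowering0 : lowering 0.
Proof.
rewrite /lowering /ladderB /ladderB1 big_ord0 P0 derivC b0.
by ring.
Qed.

Lemma prelowering0 : prelowering 0.
Proof.
rewrite /prelowering -rec0 P0 mulr1 derivX b0 mul0r addr0 mul1r mulr1.
have := ladder_compat2 0; have -> : ladderB 0 = 0.
  by rewrite /ladderB /ladderB1 big_ord0; ring.
by rewrite b0 mul0r !subr0 mulrC [ladderB 1 * _]mulrC.
Qed.

Lemma lowering_of_prelowering n :
  prelowering n -> string_equation q kappa tau b n -> lowering n.+1.
Proof.
by rewrite /prelowering /lowering => -> <- /=; rewrite /ladderA; ring.
Qed.

(** Differentiate the three-term recurrence and insert the two lowering
    relations; [ladder_compat1], at [n] and at [n.+1], makes the coefficient of
    [P n] vanish, and [ladder_compat2] evaluates the coefficient of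
    [P n.+1]. *)
Lemma prelowering_of_lowering n :
  lowering n -> lowering n.+1 -> prelowering n.+1.
Proof.
rewrite /lowering /prelowering => low0 low1.
have -> : P n.+2 = 'X * P n.+1 - (b n.+1)%:P * P n by rewrite recS addrK.
rewrite derivB !derivM derivX derivC mul0r add0r mul1r.
have A1 : 'X * ladderA n.+1 = ladderB n.+2 + ladderB n.+1 + pearsonV.
  by rewrite ladder_compat1 subrK.
have A0 : 'X * ladderA n = ladderB n.+1 + ladderB n + pearsonV.
  by rewrite ladder_compat1 subrK.
transitivity (P n.+1 * (pearsonW + 'X * (ladderB n.+2 - ladderB n.+1)
  + (b n.+1)%:P * ladderA n)).
  have -> : pearsonW * (P n.+1 + 'X * (P n.+1)^`() - (b n.+1)%:P * (P n)^`())
      = pearsonW * P n.+1 + 'X * (pearsonW * (P n.+1)^`())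
        - (b n.+1)%:P * (pearsonW * (P n)^`()) by ring.
  have -> : pearsonW * (P n.+1)^`() =
      (b n.+1)%:P * ladderA n.+1 * P n - ladderB n.+1 * P n.+1.
    by rewrite -low1 addrK.
  have -> : pearsonW * (P n)^`() =
      ladderA n * ('X * P n - P n.+1) - ladderB n * P n.
    by rewrite -rec_pred mulrCA mulrA -low0 addrK.
  have A10 := f_equal2 (fun x y => x - y) A1 A0.
  by apply: (eq_of_subr_eq (congr1 ( *%R ((b n.+1)%:P * P n)) A10)); ring.
by rewrite ladder_compat2 /ladderA !ladderA2S -[n.+1.-1]/n; ring.
Qed.

Lemma orthogonal_string n : string_equation q kappa tau b n.
Proof.
suff [low prelow] : lowering n /\ prelowering n by exact: string_of_lowering.
elim: n => [|n [low prelow]].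
  by split; [exact: lowering0|exact: prelowering0].
have low1 := lowering_of_prelowering prelow (string_of_lowering low prelow).
by split=> //; exact: prelowering_of_lowering.
Qed.

End StringEquation.

(** * Analysis on the interval *)

Section ImproperFTC.
Variable R : realType.
Notation mu := (@lebesgue_measure R).

(** The integrand is only assumed continuous in the open interval, and so may
    be unbounded at the endpoints; integrability makes the primitive [G]
    continuous on the closed one, and the mean value theorem applies to
    [G - F]. *)
Lemma improper_FTC2 (f F : R -> R) (a b : R) : a < b ->
  mu.-integrable `[a, b]%classic (EFin \o f) ->
  {in `]a, b[, continuous f} ->
  {within `[a, b]%classic, continuous F} ->
  (forall x, x \in `]a, b[ -> is_derive x (1 : R) F (f x)) ->
  (\int[mu]_(x in `[a, b]) f x)%R = F b - F a.
Proof.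
move=> ab intf cf cF dF.
pose G x := (\int[mu]_(t in `[a, x]) f t)%R.
have cG : {within `[a, b]%classic, continuous G}.
  exact: parameterized_integral_continuous (ltW ab) intf.
have Ga : G a = 0 by rewrite /G set_itv1 Rintegral_set1.
have [||c _] := @MVT R (G \- F) (fun=> 0) a b ab.
- move=> x xab; have [ax xb] : a < x /\ x < b.
    by move: xab; rewrite in_itv/= => /andP.
  have [dG G'] := continuous_FTC1_closed xb intf ax (cf x xab).
  have dGx : is_derive x 1 G (f x).
    by apply: DeriveDef dG _; rewrite -derive1E G'.
  have dFx := dF x xab.
  by have := is_deriveB dGx dFx; rewrite subrr; exact.
- by move=> x; apply: continuousB; [exact: cG|exact: cF].
- rewrite mul0r /= Ga sub0r => /subr0_eq /(canRL (subrK _)) Gb.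
  by rewrite -/(G b) Gb addrC.
Qed.

End ImproperFTC.

Section PowR.
Variable R : realType.
Implicit Types (p : {poly R}) (a x : R).

Lemma is_derive_powR_horner p a x : 0 < p.[x] ->
  is_derive x 1 (fun y => p.[y] `^ a) (a * p.[x] `^ (a - 1) * p^`().[x]).
Proof.
move=> px0; have dpow := is_derive1_powR a px0; have dp := is_derive_poly p x.
exact: (@is_derive1_comp R (fun y : R => y `^ a) (horner p) x _ _ dpow dp).
Qed.

Lemma continuous_powR_horner p a x : 0 < p.[x] ->
  {for x, continuous (fun y => p.[y] `^ a)}.
Proof.
move=> px0; apply/differentiable_continuous/derivable1_diffP.
exact: (@ex_derive _ _ _ _ _ _ _ (is_derive_powR_horner a px0)).
Qed.

(** The norm is there because the real power is discontinuous at [0]: it takes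
    the value [1] at negative arguments. *)
Lemma continuous_powR_norm a : 0 < a -> continuous (fun x : R => `|x| `^ a).
Proof.
move=> a0 x; have [->|x0] := eqVneq x 0.
  apply/cvgrPdist_lt => e e0; rewrite normr0 powR0 ?gt_eqF//.
  near=> y; rewrite sub0r normrN ger0_norm ?powR_ge0//.
  have -> : e = (e `^ a^-1) `^ a.
    by rewrite -powRrM mulVf ?gt_eqF// powRr1// ltW.
  apply: gt0_ltr_powR => //; rewrite ?nnegrE ?powR_ge0//.
  near: y; exists (e `^ a^-1) => /=; first exact: powR_gt0.
  by move=> y /=; rewrite sub0r normrN.
have cn : {for `|x|, continuous (fun y : R => y `^ a)}.
  apply/differentiable_continuous/derivable1_diffP.
  by apply: derivable_powR; rewrite in_itv/= andbT normr_gt0.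
apply: (@continuous_comp _ _ _ (fun y : R => `|y|) (fun y : R => y `^ a)) => //.
exact: norm_continuous.
Unshelve. all: by end_near. Qed.

End PowR.

Lemma finite_roots (R : realType) (p : {poly R}) :
  p != 0 -> finite_set [set x | root p x].
Proof.
move=> p0; apply: contrapT => /(infinite_set_fset (size p))[A Ap sA].
have allr : all (root p) (finmap.enum_fset A) by apply/allP => x xA; apply: Ap.
by have := max_poly_roots p0 allr (finmap.fset_uniq A); rewrite ltnNge sA.
Qed.

Section WeightIntegral.
Variables (R : realType) (alpha beta q : R).
Hypothesis q01 : 0 < q < 1.
Notation mu := (@lebesgue_measure R).
Notation w := (weight alpha beta q).
Notation D := (`[(-1)%R, 1%R]%classic : set R).

Let u : {poly R} := 1 - 'X ^+ 2.
Let g : {poly R} := 1 - q%:P * 'X ^+ 2.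

Let uE x : u.[x] = 1 - x ^+ 2. Proof. by rewrite /u !hornerE. Qed.
Let gE x : g.[x] = 1 - q * x ^+ 2. Proof. by rewrite /g !hornerE. Qed.

Let weightE : w = fun x => u.[x] `^ alpha * g.[x] `^ beta.
Proof. by apply/funext => x; rewrite uE gE. Qed.

Let u_gt0 x : x \in `]-1, 1[ -> 0 < u.[x].
Proof.
rewrite in_itv/= => /andP[x1 x2].
have -> : u.[x] = (1 - x) * (x - - 1) by rewrite uE; ring.
by rewrite mulr_gt0// subr_gt0.
Qed.

Let u_ge0 x : x \in `[-1, 1] -> 0 <= u.[x].
Proof.
rewrite in_itv/= => /andP[x1 x2].
have -> : u.[x] = (1 - x) * (x - - 1) by rewrite uE; ring.
by rewrite mulr_ge0// subr_ge0.
Qed.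

Let g_gt0 x : x \in `[-1, 1] -> 0 < g.[x].
Proof.
case/andP: q01 => q0 q1 /u_ge0; rewrite uE gE subr_ge0 subr_gt0 => x1.
by rewrite (le_lt_trans _ q1)// ler_piMr// ltW.
Qed.

Lemma weight_ge0 x : 0 <= w x.
Proof. by rewrite mulr_ge0 ?powR_ge0. Qed.

Lemma weight_gt0 x : x \in `]-1, 1[ -> 0 < w x.
Proof.
move=> x11; rewrite weightE mulr_gt0 ?powR_gt0 ?u_gt0// g_gt0//.
exact: subset_itv_oo_cc.
Qed.

Let measurable_horner (p : {poly R}) : measurable_fun setT (horner p).
Proof. by apply: continuous_measurable_fun; exact: continuous_horner. Qed.

Lemma measurable_weight A : measurable_fun A w.
Proof.
apply: measurable_funTS; rewrite weightE.
by apply: measurable_funM;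
  apply: (measurableT_comp (f := fun y : R => y `^ _)) => //;
  exact: measurable_powR.
Qed.

Lemma integrable_horner (p : {poly R}) :
  mu.-integrable D (EFin \o w) ->
  mu.-integrable D (EFin \o (fun x => p.[x] * w x)).
Proof.
move=> iw.
have Dp : measurable_fun D (horner p) by exact: measurable_funTS.
suff pb : [bounded p.[x] | x in D].
  have := @integrableMr _ _ R mu D (measurable_itv _) _ (EFin \o w) Dp pb iw.
  exact.
have : compact (horner p @` D).
  apply: continuous_compact; last exact: segment_compact.
  by apply: continuous_subspaceT; exact: continuous_horner.
move=> /compact_bounded [M [Mr hM]]; exists M; split=> // N MN x Dx.
by apply: hM => //; exists x.
Qed.

(** The integrand is the derivative of [W w p]. *)
Lemma pearson_integral (alphaN1 : -1 < alpha) (p : {poly R}) :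
  mu.-integrable D (EFin \o w) ->
  (\int[mu]_(x in D) ((pearsonW q * p^`() + ((pearsonW q)^`()
    - pearsonV q (alpha + beta * q) (alpha + beta)) * p).[x] * w x))%R = 0.
Proof.
move=> iw.
have a0 : 0 < alpha + 1 by rewrite -ltrBlDr sub0r.
pose F x := u.[x] `^ (alpha + 1) * (g.[x] `^ (beta + 1) * p.[x]).
transitivity (F 1 - F (-1)); last first.
  by rewrite /F !uE !expr2 mulrNN mulr1 subrr powR0 ?gt_eqF// !mul0r subrr.
apply: improper_FTC2.
- by lra.
- exact: integrable_horner.
- move=> x x11; apply: continuousM; first exact: continuous_horner.
  rewrite weightE.
  apply: continuousM; apply: continuous_powR_horner; first exact: u_gt0.
  by apply: g_gt0; exact: subset_itv_oo_cc.
- pose Fa (x : R) := `|u.[x]| `^ (alpha + 1) * (g.[x] `^ (beta + 1) * p.[x]).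
  apply: (@subspace_eq_continuous _ _ _ Fa).
    by move=> x; rewrite inE /F => x11; rewrite /Fa ger0_norm// u_ge0.
  suff cFa (x : R) : x \in `[-1, 1] -> {for x, continuous Fa}.
    by apply: continuous_in_subspaceT => x; rewrite inE; exact: cFa.
  move=> x11; apply: continuousM.
    apply: (@continuous_comp _ _ _ (horner u) (fun y => `|y| `^ (alpha + 1))).
      exact: continuous_horner.
    exact: continuous_powR_norm.
  apply: continuousM; last exact: continuous_horner.
  by apply: continuous_powR_horner; exact: g_gt0.
- move=> x x11; have ux := u_gt0 x11; have gx := g_gt0 (subset_itv_oo_cc x11).
  have du := is_derive_powR_horner (alpha + 1) ux.
  have dg := is_derive_powR_horner (beta + 1) gx.
  have dp := is_derive_poly p x.
  have dF : is_derive x (1 : R) F _ := is_deriveM du (is_deriveM dg dp).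
  apply: (trigger_derive dF); clear dF.
  have powR_succ (y c : R) : 0 < y -> y `^ (c + 1) = y `^ c * y.
    move=> y0; rewrite powRD ?powRr1 ?ltW//.
    by apply/implyP => _; rewrite gt_eqF.
  have VE : pearsonV q (alpha + beta * q) (alpha + beta) =
      - (alpha%:P * (u^`() * g) + beta%:P * (u * g^`())).
    by rewrite /pearsonV /u /g !poly.derivE; ring.
  rewrite VE -[pearsonW q]/(u * g) derivM opprK weightE fctE /=.
  rewrite !addrK !powR_succ// /GRing.scale/=.
  (* Opaque [u] and [g], so that evaluation does not expand them. *)
  move: u g => u' g'; rewrite !(hornerD, hornerM, hornerC).
  by ring.
Qed.

(** A vanishing integral would make the nonnegative integrand vanish almost
    everywhere, whereas its zeros are the roots of [p] and possibly the
    endpoints: finitely many points. *)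
Lemma integral_sqr_neq0 (p : {poly R}) : p != 0 ->
  mu.-integrable D (EFin \o w) ->
  (\int[mu]_(x in D) (p.[x] * p.[x] * w x)%:E)%E != 0%E.
Proof.
move=> p0 iw; apply/eqP => I0.
have mD : measurable D by exact: measurable_itv.
pose f x := (p * p).[x] * w x.
have fi : mu.-integrable D (EFin \o f) by exact: integrable_horner.
have : (\int[mu]_(x in D) `|(EFin \o f) x|)%E = 0%E.
  rewrite -[RHS]I0; apply: eq_integral => x _.
  by rewrite /= ger0_norm /f hornerM// mulr_ge0 ?weight_ge0// -expr2 sqr_ge0.
move/(ae_eq_integral_abs mu mD (measurable_int _ fi)) => [N [mN N0 subN]].
pose Z : set R := [set x | root p x] `|` [set (-1 : R); (1 : R)].
have finZ : finite_set Z.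
  by rewrite finite_setU; split; [exact: finite_roots|exact: finite_set2].
have mZ : measurable Z.
  apply: countable_measurable; first by move=> x; exact: measurable_set1.
  exact: finite_set_countable.
have DNZ : D `<=` N `|` Z.
  move=> x Dx; have [xr|xr] := boolP (root p x); first by right; left.
  have [x1|x1] := boolP (x \in `]-1, 1[); last first.
    right; right; move: Dx x1; rewrite /= !in_itv/= !le_eqVlt.
    move=> /andP[/predU1P[<-|->] /predU1P[->|->]]; rewrite ?andbT//=;
      by [left|right].
  left; apply: subN => /(_ Dx) /= [] /eqP.
  rewrite /f hornerM mulf_eq0 (mulf_eq0 p.[x]) orbb -rootE (negbTE xr)/=.
  by rewrite gt_eqF// weight_gt0.
have : (mu D <= mu (N `|` Z))%E.
  by apply: le_measure; rewrite ?inE//; exact: measurableU.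
rewrite measureU0//; last first.
  by apply: countable_lebesgue_measure0; exact: finite_set_countable.
rewrite N0 lebesgue_measure_itv/= lte_fin.
have -> : (-1 < 1 :> R) by lra.
by rewrite -EFinD lee_fin; lra.
Qed.

End WeightIntegral.

(** * The difference equation *)

Theorem theorem1p2 (R : realType) (alpha beta k : R)
    (P : nat -> {poly R}) (h b : nat -> R)
    (halpha : -1 < alpha) (hk : 0 < k ^+ 2 < 1)
    (hP : monic_orthogonal (weight alpha beta (k ^+ 2)) P h)
    (hb : recurrence_coeffs P b)
    (n : nat) (hn : (1 <= n)%N) :
  (b n.+1 - b n) ^+ 2 *
    (4 * k ^+ 4 * b n *
       ((alpha + beta + n%:R + 3 / 2) * (alpha + beta + n%:R - 1 / 2) * b n.+1
        + (alpha + beta + n%:R + 1 / 2) * (alpha + beta + n%:R - 3 / 2)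
          * b n.-1)
     + 4 * k ^+ 2 * (alpha + beta + n%:R + 1 / 2)
       * (alpha + beta + n%:R - 1 / 2) * b n
       * (2 * k ^+ 2 * b n - k ^+ 2 - 1)
     + (alpha * k ^+ 2 + beta) ^+ 2
     + k ^+ 2 * n%:R * (n%:R + 2 * alpha + 2 * beta))
  =
  (b n.+1 *
     (k ^+ 2 * (alpha + beta + n%:R + 5 / 2) * (b n.+2 + b n.+1)
      - (k ^+ 2 + 1) * (alpha + beta + n%:R + 3 / 2))
   - b n *
     (k ^+ 2 * (alpha + beta + n%:R + 1 / 2) * (b n + b n.-1)
      - (k ^+ 2 + 1) * (alpha + beta + n%:R - 1 / 2))
   + 1 / 2
   + 2 * k ^+ 2 * b n *
     ((alpha + beta + n%:R + 1 / 2) * (b n.+1 - b n) + b n + b n.-1)) ^+ 2.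
Proof.
have [q0 q1] := andP hk; case: hP => Pmonic Psize Porth; case: hb => b0 recP.
set q := k ^+ 2 in hk q0 q1 Porth *.
pose mu := @lebesgue_measure R.
pose w := weight alpha beta q.
have P0 : P 0%N = 1.
  have /size_poly1P[c _ P0c] : size (P 0%N) == 1%N by rewrite Psize.
  by move: (Pmonic 0%N); rewrite P0c monicE lead_coefC => /eqP ->.
have iw : mu.-integrable `[-1, 1] (EFin \o w).
  apply/integrableP; split.
    by apply/measurable_EFinP; exact: measurable_weight.
  have := Porth 0%N 0%N; rewrite P0 eqxx => I0.
  rewrite (_ : (\int[mu]_(x in _) _)%E = (h 0%N)%:E) ?ltry// -I0.
  by apply: eq_integral => x _; rewrite /= hornerC !mul1r ger0_norm ?weight_ge0.
have ip p := integrable_horner p iw.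
pose L0 (p : {poly R}) : R := (\int[mu]_(x in `[-1, 1]) (p.[x] * w x))%R.
have L0lin : scalar L0.
  move=> c p p'; have icp : mu.-integrable `[-1, 1]
      (EFin \o (fun x => c * (p.[x] * w x))).
    rewrite (_ : _ \o _ = EFin \o (fun x => (c *: p).[x] * w x))//.
    by apply/funext => x /=; rewrite hornerZ mulrA.
  rewrite /L0 -RintegralZl// -RintegralD//.
  by apply: eq_Rintegral => x _; rewrite /= hornerD hornerZ; ring.
pose L : {scalar {poly R}} :=
  HB.pack L0 (GRing.isLinear.Build R {poly R} R *%R L0 L0lin).
have orthP i j : L (P i * P j) = if i == j then h j else 0.
  rewrite /L/= /L0 /Rintegral; under eq_integral do rewrite hornerM.
  by rewrite Porth.
have h_neq0 m : h m != 0.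
  have := @integral_sqr_neq0 _ alpha beta q hk (P m) (monic_neq0 (Pmonic m)) iw.
  by rewrite Porth eqxx eqe.
have pearsonL p : L (pearsonW q * p^`() + ((pearsonW q)^`()
    - pearsonV q (alpha + beta * q) (alpha + beta)) * p) = 0.
  exact: (@pearson_integral _ alpha beta q hk halpha p iw).
have string := orthogonal_string P0 b0 recP orthP h_neq0 pearsonL.
case: n hn => // n _; rewrite -[n.+1.-1]/n.
have -> : k ^+ 4 = q ^+ 2 by rewrite -exprM.
have -> : alpha * q + beta = (1 + q) * (alpha + beta) - (alpha + beta * q).
  by ring.
have -> : n.+1%:R + 2 * alpha + 2 * beta = n.+1%:R + 2 * (alpha + beta).
  by ring.
exact: third_order_of_string b0 (lt0r_neq0 q0) string n.
Qed.
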